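(* The cone walk is $3.7$-competitive when the Competitive-Path algorithm is used to generate the path in $\mathrm{DT}(\mathbf X)$; that is, for every finite set of sites $\mathbf X\subset\mathbb R^2$ in general position, every $z\in\mathbf X$ and every destination $q$, the path generated has Euclidean length at most $3.7\,\|zq\|$.
   Context: $\|xy\|$ is Euclidean distance; $\mathrm{DT}(\mathbf X)$ is the Delaunay triangulation of $\mathbf X$; general position means no three sites collinear and no four cocircular. Sites and destination lie in a compact convex domain of the plane. The competitiveness of an algorithm is the worst-case ratio between the length of the path it generates and the Euclidean distance between source and destination. For distinct points $z,q\in\mathbb R^2$ and $r\ge0$, $\mathrm{Disc}(z,q,r)$ is the closed disc one of whose diameters is the segment from $z$ to the point at distance $2r$ from $z$ on the ray from $z$ through $q$; $\mathrm{Cone}(z,q,r)$ is the part of $\mathrm{Disc}(z,q,r)$ lying in the closed cone with apex $z$, axis the ray $zq$, and half-angle $\pi/8$. Cone walk from $z\in\mathbf X$ to $q$: put $Z_0=z$. Given the current site $Z_i\neq q$, grow $r$ from $0$ until either $\mathrm{Cone}(Z_i,q,r)$ contains a site other than $Z_i$, which then becomes the next stopper $Z_{i+1}$, or $\mathrm{Disc}(Z_i,q,r)$ contains $q$ (i.e. $r=\|Z_iq\|/2$), in which case the walk terminates (if $q$ is itself a site, $q$ is the last stopper). Competitive-Path: let $\lambda\le1.998$ be a constant bounding the stretch factor of Delaunay triangulations, i.e. any two sites $x,y$ of any Delaunay triangulation are joined by a path of Delaunay edges of total length at most $\lambda\|xy\|$ (such a constant is known to exist). Between consecutive stoppers $Z_i,Z_{i+1}$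 the path generated is the shortest path in $\mathrm{DT}(\mathbf X)$ that uses only vertices in the ellipse $\{x\in\mathbf X:\|xZ_i\|+\|xZ_{i+1}\|<\lambda\|Z_iZ_{i+1}\|\}$. The full path is the concatenation of these paths over consecutive stoppers. *)

(* Defs.v *)
From Stdlib Require Export Reals List.
Export ListNotations.
Open Scope R_scope.

Definition pt : Type := (R * R)%type.

Definition edist (a b : pt) : R := dist_euc (fst a) (snd a) (fst b) (snd b).

(* A finite set of sites is a list, used only through [In] and [incl];
   repetitions in the list are harmless. *)

Definition collinear (a b c : pt) : Prop :=
  (fst b - fst a) * (snd c - snd a) - (snd b - snd a) * (fst c - fst a) = 0.

Definition on_circle (c : pt) (r : R) (x : pt) : Prop := edist c x = r.

Definition cocircular (l : list pt) : Prop :=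
  exists (c : pt) (r : R), Forall (on_circle c r) l.

Definition general_position (X : list pt) : Prop :=
  (forall a b c, NoDup [a; b; c] -> incl [a; b; c] X -> ~ collinear a b c) /\
  (forall a b c d, NoDup [a; b; c; d] -> incl [a; b; c; d] X ->
     ~ cocircular [a; b; c; d]).

(* DT(X) as a simplicial complex: a set of sites is a face when some circle
   passes through all of them and has no site in its interior.  In general
   position this complex is the Delaunay triangulation, its triangles being the
   triples of sites with empty circumdisc; two sites alone form one edge. *)
Definition delaunay_face (X : list pt) (s : list pt) : Prop :=
  incl s X /\
  exists (c : pt) (r : R),
    Forall (on_circle c r) s /\ (forall y, In y X -> r <= edist c y).

Definition delaunay_edge (X : list pt) (x y : pt) : Prop :=
  x <> y /\ delaunay_face X [x; y].

(* [dt_path X x y p]: p is the list of vertices, both ends included, of a path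
   from x to y along the edges of DT(X). *)
Inductive dt_path (X : list pt) : pt -> pt -> list pt -> Prop :=
| dt_path_refl x : In x X -> dt_path X x x [x]
| dt_path_edge x y z p :
    delaunay_edge X x y -> dt_path X y z p -> dt_path X x z (x :: p).

Fixpoint path_length (p : list pt) : R :=
  match p with
  | x :: ((y :: _) as p') => edist x y + path_length p'
  | _ => 0
  end.

Definition stretch_bound (lambda : R) : Prop :=
  forall X : list pt, general_position X ->
  forall x y : pt, In x X -> In y X ->
  exists p, dt_path X x y p /\ path_length p <= lambda * edist x y.

(* The point at signed distance t from z on the ray from z through q;
   meaningful only for z <> q. *)
Definition ray_point (z q : pt) (t : R) : pt :=
  (fst z + t / edist z q * (fst q - fst z),
   snd z + t / edist z q * (snd q - snd z)).

(* The segment from z to [ray_point z q (2 * r)] is a diameter, so the centre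
   is [ray_point z q r]. *)
Definition Disc (z q : pt) (r : R) (x : pt) : Prop :=
  edist (ray_point z q r) x <= r.

(* Angle at z between x and q at most alpha, for 0 <= alpha <= PI; the apex z
   itself is included. *)
Definition in_sector (z q : pt) (alpha : R) (x : pt) : Prop :=
  cos alpha * (edist z x * edist z q) <=
  (fst x - fst z) * (fst q - fst z) + (snd x - snd z) * (snd q - snd z).

Definition Cone (z q : pt) (r : R) (x : pt) : Prop :=
  Disc z q r x /\ in_sector z q (PI / 8) x.

Definition site_in_cone (X : list pt) (z q : pt) (r : R) (w : pt) : Prop :=
  In w X /\ w <> z /\ Cone z q r w.

Definition walk_event (X : list pt) (z q : pt) (r : R) : Prop :=
  (exists w, site_in_cone X z q r w) \/ Disc z q r q.

(* r is the radius at which the growth from 0 stops. *)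
Definition first_event (X : list pt) (z q : pt) (r : R) : Prop :=
  0 <= r /\ walk_event X z q r /\
  (forall r', 0 <= r' < r -> ~ walk_event X z q r').

(* When several sites, or a site and q, are reached at the same radius, every
   choice is allowed.  If q is a site then it lies in the cone as soon as it
   lies in the disc, hence the walk only ever ends at q. *)
Definition next_stopper (X : list pt) (q z w : pt) : Prop :=
  z <> q /\ exists r, first_event X z q r /\ site_in_cone X z q r w.

Definition walk_ends (X : list pt) (q z : pt) : Prop :=
  z = q \/ (~ In q X /\ exists r, first_event X z q r /\ Disc z q r q).

(* [cone_walk X q z s]: s is the list of stoppers, starting with z, of a
   complete cone walk from z to q. *)
Inductive cone_walk (X : list pt) (q : pt) : pt -> list pt -> Prop :=
| cone_walk_end z : walk_ends X q z -> cone_walk X q z [z]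
| cone_walk_step z w s :
    next_stopper X q z w -> cone_walk X q w s -> cone_walk X q z (z :: s).

Definition in_ellipse (lambda : R) (a b x : pt) : Prop :=
  edist x a + edist x b < lambda * edist a b.

Definition ellipse_path (X : list pt) (lambda : R) (a b : pt) (p : list pt)
    : Prop :=
  dt_path X a b p /\ Forall (in_ellipse lambda a b) p.

Definition shortest_ellipse_path (X : list pt) (lambda : R) (a b : pt)
    (p : list pt) : Prop :=
  ellipse_path X lambda a b p /\
  (forall p', ellipse_path X lambda a b p' -> path_length p <= path_length p').

(* [competitive_path X lambda s P]: P is the vertex list of the concatenation
   of shortest paths between consecutive stoppers of s; [tl] avoids listing the
   common stopper twice. *)
Inductive competitive_path (X : list pt) (lambda : R)
    : list pt -> list pt -> Prop :=
| competitive_path_one z : competitive_path X lambda [z] [z]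
| competitive_path_step z w s p P :
    shortest_ellipse_path X lambda z w p ->
    competitive_path X lambda (w :: s) P ->
    competitive_path X lambda (z :: w :: s) (p ++ tl P).

(* Main.v *)
Require Import Defs.
From Stdlib Require Import Reals List.
From Stdlib Require Import Lra Lia Classical.

(** Write [d = edist z q].  The disc at which a step stops has diameter at most
    [d], so the next stopper [w] lies in the disc with diameter [zq], and the
    angle at [z] between [w] and [q] is at most [PI / 8]; the law of cosines
    then gives
    [edist z w <= 1.85 * (edist z q - edist w q)] ([stopper_progress]).  These
    bounds telescope: the stoppers are joined by segments of total length at
    most [1.85 * d].  Each of them is replaced by a path at most
    [lambda <= 1.998] times as long, and [1.998 * 1.85 < 3.7].

    The delicate point is that the ellipse is open.  A path of length at most
    [lambda * edist a b] from [a] to [b] keeps its vertices in the closed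
    ellipse only, and it could go straight to a vertex of the boundary and
    straight on to [b].  So the bound on the stretch factor is not applied to
    [X] but to its image under a slight stretching in the direction orthogonal
    to [ab] ([widen]).  This map fixes [a] and [b] and is expanding; off the
    line [ab] it strictly increases the sum of the distances to [a] and [b].
    For a small enough stretching the image is still in general position, and
    a pair that is not a Delaunay edge of [X] does not become one, because
    not being an edge is witnessed by strict inequalities on two further sites
    ([edge_or_blocked]).  A path found in the image is thus the image of a path
    of [X], and for its vertices off the line [ab] the closed bounds in the
    image become strict bounds in [X] ([ellipse_path_exists]).  On the line
    [ab] only [a] and [b] are sites, and they lie inside the ellipse because
    [lambda > 1]: in a flat kite the long diagonal is not an edge
    ([stretch_bound_gt_1]).

    Existence of the walk holds since stoppers come strictly closer to [q] and
    sites are finitely many; existence of shortest paths holds since a path of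
    bounded length has boundedly many edges. *)

(** * Finite minima and the Euclidean distance *)

Lemma exists_min (A : Type) (P : A -> Prop) (f : A -> R) (l : list A) :
  (exists x, In x l /\ P x) ->
  exists m, In m l /\ P m /\ (forall x, In x l -> P x -> f m <= f x).
Proof.
induction l as [|a l IH]; intros [x [Hx HP]]; [destruct Hx|].
destruct (classic (exists y, In y l /\ P y)) as [Hl|Hl].
- destruct (IH Hl) as [m [Hm [HPm Hmin]]].
  destruct (classic (P a /\ f a <= f m)) as [[HPa Ha]|Ha].
  + exists a; split; [now left|split; [assumption|]].
    intros y [<-|Hy] HPy; [lra|].
    specialize (Hmin y Hy HPy); lra.
  + exists m; split; [now right|split; [assumption|]].
    intros y [<-|Hy] HPy; [|now apply Hmin].
    destruct (Rle_or_lt (f m) (f a)) as [H|H]; [assumption|].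
    exfalso; apply Ha; split; [assumption|lra].
- assert (Ha : forall y, In y (a :: l) -> P y -> y = a).
  { intros y [<-|Hy] HPy; [reflexivity|].
    exfalso; apply Hl; now exists y. }
  rewrite (Ha x Hx HP) in HP.
  exists a; split; [now left|split; [assumption|]].
  intros y Hy HPy; rewrite (Ha y Hy HPy); lra.
Qed.

Lemma le_of_sqr a b : 0 <= b -> a ^ 2 <= b ^ 2 -> a <= b.
Proof. intros; nra. Qed.

Lemma edist_nonneg a b : 0 <= edist a b.
Proof. apply sqrt_pos. Qed.

Lemma edist_sqr a b :
  edist a b ^ 2 = (fst a - fst b) ^ 2 + (snd a - snd b) ^ 2.
Proof.
unfold edist, dist_euc; rewrite pow2_sqrt; [unfold Rsqr; ring|].
apply Rplus_le_le_0_compat; apply Rle_0_sqr.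
Qed.

Lemma edist_sym a b : edist a b = edist b a.
Proof. apply distance_symm. Qed.

Lemma edist_refl a : edist a a = 0.
Proof. apply distance_refl. Qed.

Lemma edist_triangle a b c : edist a c <= edist a b + edist b c.
Proof. apply triangle. Qed.

Lemma edist_pos a b : a <> b -> 0 < edist a b.
Proof.
intros Hab; pose proof (edist_nonneg a b) as H0; pose proof (edist_sqr a b) as Hs.
destruct (Rle_or_lt (edist a b) 0) as [H|H]; [|assumption].
exfalso; apply Hab; replace (edist a b) with 0 in Hs by lra.
rewrite <- !Rsqr_pow2, Rsqr_0 in Hs; symmetry in Hs.
apply Rplus_sqr_eq_0 in Hs.
destruct a, b; simpl in *; f_equal; lra.
Qed.

(** * Progress and existence of the cone walk *)

Definition inner (z x y : pt) : R :=
  (fst x - fst z) * (fst y - fst z) + (snd x - snd z) * (snd y - snd z).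

Lemma inner_diag z q : inner z q q = edist z q ^ 2.
Proof. rewrite edist_sqr; unfold inner; ring. Qed.

Lemma edist_sqr_inner z w q :
  edist w q ^ 2 = edist z q ^ 2 + edist z w ^ 2 - 2 * inner z w q.
Proof. rewrite !edist_sqr; unfold inner; ring. Qed.

Lemma Disc_inner z q r x : z <> q -> 0 <= r ->
  (Disc z q r x <-> edist z x ^ 2 * edist z q <= 2 * r * inner z x q).
Proof.
intros Hzq Hr; pose proof (edist_pos _ _ Hzq) as Hd.
assert (E : edist (ray_point z q r) x ^ 2 * edist z q =
   r ^ 2 * edist z q + (edist z x ^ 2 * edist z q - 2 * r * inner z x q)).
{ pose proof (edist_sqr z q) as Hq.
  rewrite (edist_sqr (ray_point z q r) x), (edist_sqr z x).
  unfold ray_point, inner; simpl fst; simpl snd.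
  set (d := edist z q) in *.
  assert (Hu : (r / d * (fst q - fst z)) ^ 2 + (r / d * (snd q - snd z)) ^ 2
               = r ^ 2).
  { transitivity ((r / d) ^ 2 * d ^ 2); [rewrite Hq; ring|field; lra]. }
  transitivity (((r / d * (fst q - fst z)) ^ 2 + (r / d * (snd q - snd z)) ^ 2)
     * d + ((fst z - fst x) ^ 2 + (snd z - snd x) ^ 2) * d
     - 2 * r * inner z x q); [unfold inner; field; lra|].
  rewrite Hu; unfold inner; ring. }
unfold Disc; split; intros H.
- assert (edist (ray_point z q r) x ^ 2 <= r ^ 2)
    by (pose proof (edist_nonneg (ray_point z q r) x); nra).
  nra.
- apply le_of_sqr; [assumption|]; nra.
Qed.

Lemma Disc_target z q r : z <> q -> 0 <= r ->
  (Disc z q r q <-> edist z q / 2 <= r).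
Proof.
intros Hzq Hr; rewrite (Disc_inner z q r q Hzq Hr), inner_diag.
pose proof (edist_pos _ _ Hzq) as Hd.
assert (0 < edist z q ^ 2) by nra.
split; intros H1; nra.
Qed.

Lemma first_event_radius X z q r :
  z <> q -> first_event X z q r -> 2 * r <= edist z q.
Proof.
intros Hzq [Hr [_ Hmin]]; pose proof (edist_pos _ _ Hzq).
destruct (Rle_or_lt (2 * r) (edist z q)) as [H1|H1]; [assumption|exfalso].
apply (Hmin (edist z q / 2)); [lra|].
right; apply Disc_target; [assumption|lra|lra].
Qed.

Lemma cos_PI8_ge : 0.86 <= cos (PI / 8).
Proof.
pose proof PI_RGT_0.
assert (H1 : cos (PI / 6) <= cos (PI / 8)) by (apply cos_decr_1; lra).
rewrite cos_PI6 in H1.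
assert (1.72 <= sqrt 3).
{ rewrite <- (sqrt_pow2 1.72) by lra; apply sqrt_le_1; lra. }
lra.
Qed.

Lemma in_sector_inner_pos z q w :
  z <> q -> w <> z -> in_sector z q (PI / 8) w -> 0 < inner z w q.
Proof.
intros Hzq Hwz Hs; unfold in_sector in Hs; fold (inner z w q) in Hs.
pose proof cos_PI8_ge.
assert (0 < edist z w * edist z q)
  by (apply Rmult_lt_0_compat; apply edist_pos; auto).
nra.
Qed.

(** With [l = edist z w] and [D = inner z w q], the disc gives [l ^ 2 <= D] and
    the sector gives [0.86 * l * d <= D].  By the law of cosines the claim is
    [l ^ 2 * (1 - 1 / k ^ 2) <= 2 * D - 2 * d * l / k] with [k = 1.85], and it
    suffices that the cosine of the half-angle be at least
    [2 * k / (k ^ 2 + 1)], which is less than [0.84].  Squaring is legitimate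
    because [l <= d]. *)
Lemma stopper_progress X q z w : next_stopper X q z w ->
  edist z w <= 1.85 * (edist z q - edist w q).
Proof.
intros [Hzq [r [He [_ [Hwz [HD Hs]]]]]].
pose proof (first_event_radius _ _ _ _ Hzq He) as Hr2.
pose proof (in_sector_inner_pos _ _ _ Hzq Hwz Hs) as Hpos.
destruct He as [Hr _].
apply Disc_inner in HD; [|assumption..].
unfold in_sector in Hs; fold (inner z w q) in Hs.
pose proof cos_PI8_ge as Hc.
pose proof (edist_pos _ _ Hzq) as Hd.
pose proof (edist_nonneg z w) as Hl.
pose proof (edist_sqr_inner z w q) as Hlaw.
set (d := edist z q) in *; set (l := edist z w) in *.
set (D := inner z w q) in *.
assert (HlD : l ^ 2 <= D).
{ assert (l ^ 2 * d <= D * d) by nra. nra. }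
assert (HcD : 0.86 * (l * d) <= D).
{ assert (0 <= l * d) by nra. nra. }
assert (Hld : l <= d).
{
  (* Cauchy-Schwarz, from Lagrange's identity *)
  assert (HDld : D <= l * d).
  { assert (0 <= (l * d) ^ 2 - D ^ 2).
    { unfold l, d, D, inner; rewrite Rpow_mult_distr, !edist_sqr.
      match goal with |- 0 <= ?e => replace e with
       (((fst w - fst z) * (snd q - snd z) - (snd w - snd z) * (fst q - fst z)) ^ 2)
       by ring end.
      apply pow2_ge_0. }
    apply le_of_sqr; [nra|lra]. }
  destruct (Rle_or_lt l d); [assumption|]. nra. }
assert (edist w q <= d - l / 1.85); [|lra].
apply le_of_sqr; [lra|].
rewrite Hlaw; nra.
Qed.

Lemma stopper_closer X q z w : next_stopper X q z w -> edist w q < edist z q.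
Proof.
intros H; pose proof (stopper_progress _ _ _ _ H).
destruct H as [_ [r [_ [_ [Hwz _]]]]].
pose proof (edist_pos z w (fun e => Hwz (eq_sym e))); lra.
Qed.

(** A site in the sector is in the cone exactly from the radius
    [edist z w ^ 2 * edist z q / (2 * inner z w q)] on; the first event is at
    the least of these radii and [edist z q / 2]. *)
Lemma first_event_exists X z q : z <> q -> exists r, first_event X z q r.
Proof.
intros Hzq; pose proof (edist_pos _ _ Hzq) as Hd.
set (rho w := edist z w ^ 2 * edist z q / (2 * inner z w q)).
set (S w := w <> z /\ in_sector z q (PI / 8) w).
assert (Hrho : forall w r, S w -> 0 <= r -> (Disc z q r w <-> rho w <= r)).
{ intros w r [Hwz Hs] Hr; rewrite Disc_inner by assumption.
  pose proof (in_sector_inner_pos _ _ _ Hzq Hwz Hs) as Hp.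
  assert (E : rho w * (2 * inner z w q) = edist z w ^ 2 * edist z q)
    by (unfold rho; field; lra).
  rewrite <- E; split; intros H; nra. }
assert (Hrho0 : forall w, S w -> 0 <= rho w).
{ intros w [Hwz Hs].
  pose proof (in_sector_inner_pos _ _ _ Hzq Hwz Hs) as Hp.
  apply Rle_mult_inv_pos; [|lra].
  apply Rmult_le_pos; [apply pow2_ge_0|lra]. }
assert (Hend : walk_event X z q (edist z q / 2))
  by (right; apply Disc_target; [assumption|lra|lra]).
destruct (classic (exists w, In w X /\ (S w /\ rho w <= edist z q / 2)))
  as [He|He].
- destruct (exists_min _ _ rho _ He) as [m [Hm [[HSm Hmd] Hmin]]].
  exists (rho m); split; [auto|split].
  + left; exists m; split; [assumption|split; [apply HSm|split; [|apply HSm]]].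
    apply Hrho; auto; lra.
  + intros r' Hr' [[w [Hw [Hwz [HwD Hws]]]]|HD].
    * assert (HSw : S w) by (split; assumption).
      apply Hrho in HwD; [|assumption|lra].
      assert (rho m <= rho w) by (apply Hmin; [assumption|split; [assumption|lra]]).
      lra.
    * apply Disc_target in HD; [lra|assumption|lra].
- exists (edist z q / 2); split; [lra|split; [assumption|]].
  intros r' Hr' [[w [Hw [Hwz [HwD Hws]]]]|HD].
  + assert (HSw : S w) by (split; assumption).
    apply Hrho in HwD; [|assumption|lra].
    apply He; exists w; split; [assumption|split; [assumption|lra]].
  + apply Disc_target in HD; [lra|assumption|lra].
Qed.

Lemma step_or_end X q z :
  (exists w, In w X /\ next_stopper X q z w) \/ walk_ends X q z.
Proof.
destruct (classic (z = q)) as [Hzq|Hzq]; [right; now left|].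
destruct (first_event_exists X z q Hzq) as [r Hr].
assert (Hr' := Hr); destruct Hr as [Hr0 [[[w Hw]|HD] Hmin]].
- left; exists w; split; [apply Hw|split; [assumption|now exists r]].
- destruct (classic (In q X)) as [Hq|Hq].
  + left; exists q; split; [assumption|split; [assumption|]].
    exists r; split; [assumption|split; [assumption|split; [auto|]]].
    split; [assumption|].
    unfold in_sector; fold (inner z q q); rewrite inner_diag.
    pose proof (COS_bound (PI / 8)); pose proof (edist_nonneg z q); nra.
  + right; right; split; [assumption|now exists r].
Qed.

Lemma cone_walk_exists X q z : In z X -> exists s, cone_walk X q z s.
Proof.
intros Hz; apply NNPP; intros Hno.
(* a site closest to q among those from which no walk starts *)
destruct (exists_min pt (fun u => ~ exists s, cone_walk X q u s)
           (fun u => edist u q) X) as [m [Hm [HPm Hmin]]].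
{ now exists z. }
apply HPm; destruct (step_or_end X q m) as [[w [Hw Hstep]]|Hend].
- destruct (classic (exists s, cone_walk X q w s)) as [[s Hs]|Hs].
  + exists (m :: s); now apply cone_walk_step with w.
  + pose proof (Hmin w Hw Hs); pose proof (stopper_closer _ _ _ _ Hstep); lra.
- exists [m]; now apply cone_walk_end.
Qed.

(** * Paths and their lengths *)

Lemma dt_path_head X a b p : dt_path X a b p -> p = a :: tl p.
Proof. now destruct 1. Qed.

Lemma dt_path_start_in X a b p : dt_path X a b p -> In a X.
Proof.
destruct 1 as [x Hx|x y z p [_ [Hi _]] _]; [assumption|].
apply Hi; now left.
Qed.

Lemma dt_path_incl X a b p : dt_path X a b p -> incl p X.
Proof.
induction 1 as [x Hx|x y z p [_ [Hi _]] _ IH].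
- intros u [<-|[]]; assumption.
- intros u [<-|Hu]; [apply Hi; now left|now apply IH].
Qed.

Lemma dt_path_first_edge X a b p : dt_path X a b p -> a <> b ->
  exists y, delaunay_edge X a y /\ In y p.
Proof.
destruct 1 as [x Hx|x y z p He Hp]; [contradiction|intros _].
exists y; split; [assumption|right].
rewrite (dt_path_head _ _ _ _ Hp); now left.
Qed.

Lemma path_length_cons X x y z p : dt_path X y z p ->
  path_length (x :: p) = edist x y + path_length p.
Proof. intros H; now rewrite (dt_path_head _ _ _ _ H). Qed.

Lemma dt_path_ge_edist X a b p : dt_path X a b p -> edist a b <= path_length p.
Proof.
induction 1 as [x Hx|x y z p _ Hp IH].
- rewrite edist_refl; simpl; lra.
- rewrite (path_length_cons X x y z p Hp).
  pose proof (edist_triangle x y z); lra.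
Qed.

Lemma dt_path_ge_detour X a b p v : dt_path X a b p -> In v p ->
  edist a v + edist v b <= path_length p.
Proof.
induction 1 as [x Hx|x y z p He Hp IH].
- intros [<-|[]]; rewrite edist_refl; simpl; lra.
- rewrite (path_length_cons X x y z p Hp); intros [<-|Hv].
  + rewrite edist_refl; pose proof (edist_triangle x y z).
    pose proof (dt_path_ge_edist _ _ _ _ Hp); lra.
  + pose proof (edist_triangle x y v); specialize (IH Hv); lra.
Qed.

Lemma path_length_app_tl X a b p P : dt_path X a b p -> P = b :: tl P ->
  path_length (p ++ tl P) = path_length p + path_length P.
Proof.
intros Hp HP; induction Hp as [x Hx|x y z p _ Hp IH].
- simpl (path_length [x]); simpl app; rewrite <- HP; ring.
- rewrite (path_length_cons X x y z p Hp), Rplus_assoc, <- (IH HP).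
  now rewrite (dt_path_head _ _ _ _ Hp).
Qed.

(** * Shortest paths inside the ellipse *)

Lemma min_separation X : exists delta, 0 < delta /\
  (forall x y, In x X -> In y X -> x <> y -> delta <= edist x y).
Proof.
destruct (classic (exists c, In c (list_prod X X) /\ fst c <> snd c))
  as [He|He].
- destruct (exists_min _ _ (fun c => edist (fst c) (snd c)) _ He)
    as [m [_ [Hm Hmin]]].
  exists (edist (fst m) (snd m)); split; [now apply edist_pos|].
  intros x y Hx Hy Hxy; apply (Hmin (x, y)); [|assumption].
  now apply in_prod.
- exists 1; split; [lra|]; intros x y Hx Hy Hxy; exfalso.
  apply He; exists (x, y); split; [now apply in_prod|assumption].
Qed.

(** Bounds the number of vertices of a path by its length, which leaves finitely
    many candidates for a shortest path. *)
Lemma dt_path_length_ge_size X delta a b p :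
  (forall x y, In x X -> In y X -> x <> y -> delta <= edist x y) ->
  dt_path X a b p -> delta * (INR (length p) - 1) <= path_length p.
Proof.
intros Hdelta; induction 1 as [x Hx|x y z p He Hp IH].
- simpl; lra.
- rewrite (path_length_cons X x y z p Hp).
  destruct He as [Hxy [Hi _]].
  assert (delta <= edist x y)
    by (apply Hdelta; [apply Hi; now left|apply Hi; right; now left|assumption]).
  simpl length; rewrite S_INR; lra.
Qed.

Lemma finitely_many_lists (A : Type) (X : list A) (n : nat) :
  exists L, forall p, incl p X -> (length p <= n)%nat -> In p L.
Proof.
induction n as [|n [L HL]].
- exists [[]]; intros [|x p] _ Hl; [now left|simpl in Hl; lia].
- exists ([] :: flat_map (fun l => map (fun x => x :: l) X) L).
  intros [|x p] Hp Hl; [now left|right].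
  apply in_flat_map; exists p; split.
  + apply HL; [intros u Hu; apply Hp; now right|simpl in Hl; lia].
  + apply (in_map (fun x => x :: p)); apply Hp; now left.
Qed.

Lemma shortest_exists X lambda a b p0 : ellipse_path X lambda a b p0 ->
  exists p, shortest_ellipse_path X lambda a b p.
Proof.
intros H0; destruct (min_separation X) as [delta [Hd Hsep]].
destruct (INR_unbounded (path_length p0 / delta + 1)) as [n Hn].
destruct (finitely_many_lists _ X n) as [L HL].
assert (Hin : forall p, ellipse_path X lambda a b p ->
                path_length p <= path_length p0 -> In p L).
{ intros p [Hp _] Hle; apply HL; [now apply (dt_path_incl X a b)|].
  apply INR_le.
  pose proof (dt_path_length_ge_size X delta a b p Hsep Hp) as Hsz.
  assert (E : path_length p0 / delta * delta = path_length p0) by (field; lra).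
  nra. }
destruct (exists_min _ (ellipse_path X lambda a b) path_length L)
  as [m [_ [Hm Hmin]]].
{ exists p0; split; [apply Hin; [assumption|lra]|assumption]. }
exists m; split; [assumption|]; intros p' Hp'.
assert (path_length m <= path_length p0)
  by (apply Hmin; [apply Hin; [assumption|lra]|assumption]).
destruct (Rle_or_lt (path_length p') (path_length p0)) as [Hle|Hlt]; [|lra].
apply Hmin; [now apply Hin|assumption].
Qed.

(** * Delaunay edges *)

Definition orient (x y s : pt) : R :=
  (fst y - fst x) * (snd s - snd x) - (snd y - snd x) * (fst s - fst x).

Definition chord (x y s : pt) : R := inner s x y.

(** The quotient of [chord] by the absolute value of [orient] is the cotangent
    of the angle under which [xy] is seen; [s] and [t] lie on opposite sides of
    [xy], and the angles at them add up to more than [PI]. *)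
Definition blocked (x y s t : pt) : Prop :=
  0 < orient x y s /\ orient x y t < 0 /\
  chord x y t * orient x y s < chord x y s * orient x y t.

(** A circle through [x] and [y] has its centre [c] on the bisector of [xy];
    up to the factor [edist x y ^ 2], the power of [s] is affine in the
    position of [c] there. *)
Lemma blocked_not_edge X x y s t : In s X -> In t X -> blocked x y s t ->
  ~ delaunay_edge X x y.
Proof.
intros Hs Ht [Hos [Hot Hb]] [Hxy [_ [c [r [Hc Hempty]]]]].
inversion_clear Hc as [|? ? Hx Hc']; inversion_clear Hc' as [|? ? Hy _].
unfold on_circle in *.
pose proof (edist_pos _ _ Hxy) as Hd.
set (T := 2 * ((fst x + fst y) / 2 - fst c) * (snd y - snd x)
          - 2 * ((snd x + snd y) / 2 - snd c) * (fst y - fst x)).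
assert (Hbis : edist c x ^ 2 = edist c y ^ 2) by (rewrite Hx, Hy; ring).
rewrite !edist_sqr in Hbis.
assert (Hpow : forall u, In u X ->
          0 <= edist x y ^ 2 * chord x y u - T * orient x y u).
{ intros u Hu; pose proof (Hempty u Hu) as Hru; rewrite <- Hx in Hru.
  replace (edist x y ^ 2 * chord x y u - T * orient x y u)
    with (edist x y ^ 2 * (edist c u ^ 2 - edist c x ^ 2)).
  - pose proof (edist_nonneg c x); apply Rmult_le_pos; nra.
  - rewrite !edist_sqr; unfold T, chord, inner, orient.
    apply Rminus_diag_uniq.
    match type of Hbis with ?A = ?B =>
      transitivity ((B - A) * inner x y u) end.
    + unfold inner; field.
    + rewrite Hbis; ring. }
pose proof (Hpow s Hs) as Ps; pose proof (Hpow t Ht) as Pt.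
assert (0 < edist x y ^ 2) by nra.
assert (Ps' : (edist x y ^ 2 * chord x y s - T * orient x y s) * orient x y t <= 0)
  by nra.
assert (Pt' : 0 <= (edist x y ^ 2 * chord x y t - T * orient x y t) * orient x y s)
  by nra.
nra.
Qed.

(** The sites on the left of [xy] bound the position of the centre on the
    bisector from above, those on the right bound it from below; if no two of
    these bounds contradict each other then all of them hold at an extreme
    one. *)
Lemma feasible_slope X x y :
  (forall s t, In s X -> In t X -> ~ blocked x y s t) ->
  exists T, forall s, In s X -> orient x y s <> 0 ->
    T * orient x y s <= chord x y s.
Proof.
intros Hnb; set (f s := chord x y s / orient x y s).
assert (Hf : forall s, orient x y s <> 0 -> chord x y s = f s * orient x y s)
  by (intros s Hs; unfold f; field; assumption).
assert (Hlt : forall s t, In s X -> In t X -> 0 < orient x y s ->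
                orient x y t < 0 -> f t <= f s).
{ intros s t Hs Ht Hos Hot; apply Rnot_lt_le; intros Hft.
  apply (Hnb s t Hs Ht); split; [assumption|split; [assumption|]].
  rewrite (Hf s), (Hf t) by lra.
  assert (0 < orient x y s * - orient x y t) by nra; nra. }
assert (Hside : forall T,
  (forall s, In s X -> 0 < orient x y s -> T <= f s) ->
  (forall s, In s X -> orient x y s < 0 -> f s <= T) ->
  forall s, In s X -> orient x y s <> 0 -> T * orient x y s <= chord x y s).
{ intros T Hup Hlo s Hs Ho; rewrite (Hf s Ho).
  destruct (Rdichotomy _ _ Ho) as [Hn|Hp];
    [specialize (Hlo s Hs Hn)|specialize (Hup s Hs Hp)]; nra. }
destruct (classic (exists t, In t X /\ orient x y t < 0)) as [Hr|Hr].
- destruct (exists_min _ _ (fun t => - f t) _ Hr) as [t [Ht [Hot Hmax]]].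
  exists (f t); apply Hside; intros s Hs Ho; [now apply Hlt|].
  specialize (Hmax s Hs Ho); lra.
- destruct (classic (exists s, In s X /\ 0 < orient x y s)) as [Hl|Hl].
  + destruct (exists_min _ _ f _ Hl) as [t [Ht [Hot Hmin]]].
    exists (f t); apply Hside; intros s Hs Ho; [now apply Hmin|].
    exfalso; apply Hr; now exists s.
  + exists 0; apply Hside; intros s Hs Ho; exfalso.
    * apply Hl; now exists s.
    * apply Hr; now exists s.
Qed.

Lemma edge_or_blocked X x y : general_position X -> In x X -> In y X ->
  x <> y -> ~ delaunay_edge X x y ->
  exists s t, In s X /\ In t X /\ blocked x y s t.
Proof.
intros [Hcol _] Hx Hy Hxy Hne; apply NNPP; intros Hnb; apply Hne.
destruct (feasible_slope X x y) as [T HT].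
{ intros s t Hs Ht Hb; apply Hnb; now exists s, t. }
split; [assumption|split].
{ intros u [<-|[<-|[]]]; assumption. }
set (c := ((fst x + fst y) / 2 - T / 2 * (snd y - snd x),
           (snd x + snd y) / 2 + T / 2 * (fst y - fst x))).
assert (Hpow : forall u, edist c u ^ 2 - edist c x ^ 2
                         = chord x y u - T * orient x y u).
{ intros u; rewrite !edist_sqr; unfold c, chord, inner, orient; simpl; field. }
exists c, (edist c x); split.
- constructor; [reflexivity|constructor; [|constructor]].
  apply Rle_antisym; apply le_of_sqr; try apply edist_nonneg;
    pose proof (Hpow y) as Hy'; unfold chord, inner, orient in Hy'; nra.
- intros u Hu; apply le_of_sqr; [apply edist_nonneg|].
  enough (0 <= chord x y u - T * orient x y u)
    by (rewrite <- Hpow in *; lra).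
  destruct (Req_dec (orient x y u) 0) as [Ho|Ho];
    [|specialize (HT u Hu Ho); lra].
  (* the only sites on the line xy are x and y themselves *)
  assert (Hu' : u = x \/ u = y).
  { apply NNPP; intros Hux; apply not_or_and in Hux; destruct Hux.
    apply (Hcol x y u); [|intros v [<-|[<-|[<-|[]]]]; assumption|exact Ho].
    repeat constructor; simpl; intuition (subst; auto). }
  rewrite Ho; unfold chord, inner; destruct Hu' as [-> | ->]; lra.
Qed.

(** * Small perturbations *)

Definition near0 (P : R -> Prop) : Prop :=
  exists d, 0 < d /\ forall e, 0 < e < d -> P e.

Lemma near0_and P Q : near0 P -> near0 Q -> near0 (fun e => P e /\ Q e).
Proof.
intros [d1 [H1 K1]] [d2 [H2 K2]]; exists (Rmin d1 d2); split.
- now apply Rmin_pos.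
- intros e He; pose proof (Rmin_l d1 d2); pose proof (Rmin_r d1 d2).
  split; [apply K1|apply K2]; lra.
Qed.

Lemma near0_imp (P Q : R -> Prop) :
  (forall e, 0 < e -> P e -> Q e) -> near0 P -> near0 Q.
Proof.
intros H [d [Hd HP]]; exists d; split; [assumption|].
intros e He; apply H; [apply He|auto].
Qed.

Lemma near0_true (P : R -> Prop) : (forall e, 0 < e -> P e) -> near0 P.
Proof. intros H; exists 1; split; [lra|]; intros e He; now apply H. Qed.

Lemma near0_forall (A : Type) (l : list A) (P : A -> R -> Prop) :
  (forall x, In x l -> near0 (P x)) ->
  near0 (fun e => forall x, In x l -> P x e).
Proof.
induction l as [|a l IH]; intros H.
- apply near0_true; intros e _ x [].
- apply (near0_imp (fun e => P a e /\ forall x, In x l -> P x e)).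
  + intros e _ [Ha Hl] x [<-|Hx]; auto.
  + apply near0_and; [apply H; now left|].
    apply IH; intros x Hx; apply H; now right.
Qed.

Lemma near0_pos (g : R -> R) :
  continuity_pt g 0 -> 0 < g 0 -> near0 (fun e => 0 < g e).
Proof.
intros Hg Hpos; destruct (Hg (g 0) Hpos) as [d [Hd H]].
exists d; split; [assumption|]; intros e He.
assert (Hdist : R_dist (g e) (g 0) < g 0).
{ apply H; split; [split; [exact I|lra]|].
  simpl; unfold R_dist; rewrite Rabs_pos_eq; lra. }
unfold R_dist in Hdist; apply Rabs_def2 in Hdist; lra.
Qed.

(** The determinant of the three vectors from [x] to [y], [u] and [s] lifted to
    the paraboloid, where circles become plane sections, expanded along the
    third coordinates. *)
Definition incircle (x y u s : pt) : R :=
  inner x y y * orient x u s - inner x u u * orient x y s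
  + inner x s s * orient x y u.

Lemma cocircular_incircle x y u s :
  cocircular [x; y; u; s] -> incircle x y u s = 0.
Proof.
intros [c [r Hc]].
assert (H : forall v, In v [x; y; u; s] -> inner x v v = 2 * inner x v c).
{ intros v Hv.
  pose proof (proj1 (Forall_forall _ _) Hc v Hv) as Hv'.
  pose proof (proj1 (Forall_forall _ _) Hc x (or_introl eq_refl)) as Hx'.
  unfold on_circle in *.
  assert (E : edist c v ^ 2 = edist c x ^ 2) by (rewrite Hv', Hx'; ring).
  rewrite !edist_sqr in E; unfold inner; nra. }
unfold incircle; rewrite !H by (simpl; tauto).
unfold inner, orient; ring.
Qed.

(** For [x], [y], [u] not collinear the centre is found by Cramer's rule. *)
Lemma incircle_cocircular x y u s :
  orient x y u <> 0 -> incircle x y u s = 0 -> cocircular [x; y; u; s].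
Proof.
intros Ho Hi.
set (c1 := (inner x y y * (snd u - snd x) - inner x u u * (snd y - snd x))
           / (2 * orient x y u)).
set (c2 := (inner x u u * (fst y - fst x) - inner x y y * (fst u - fst x))
           / (2 * orient x y u)).
set (c := (fst x + c1, snd x + c2)).
assert (Hpow : forall v, orient x y u * (edist c v ^ 2 - edist c x ^ 2)
                         = incircle x y u v).
{ intros v; rewrite !edist_sqr.
  transitivity (orient x y u * inner x v v
    - 2 * (orient x y u * c1 * (fst v - fst x)
           + orient x y u * c2 * (snd v - snd x))).
  - unfold c, inner; simpl; ring.
  - replace (orient x y u * c1) with
      ((inner x y y * (snd u - snd x) - inner x u u * (snd y - snd x)) / 2)
      by (unfold c1; field; assumption).
    replace (orient x y u * c2) with
      ((inner x u u * (fst y - fst x) - inner x y y * (fst u - fst x)) / 2)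
      by (unfold c2; field; assumption).
    unfold incircle, orient; field. }
assert (Hon : forall v, incircle x y u v = 0 -> edist c v = edist c x).
{ intros v Hv; rewrite <- Hpow in Hv.
  apply Rmult_integral in Hv; destruct Hv as [Hv|Hv]; [contradiction|].
  apply Rle_antisym; apply le_of_sqr; try apply edist_nonneg; lra. }
exists c, (edist c x); repeat constructor; unfold on_circle; apply Hon;
  [..|assumption]; unfold incircle, inner, orient; ring.
Qed.

(** * Stretching the plane orthogonally to two sites *)

(** The affine map that fixes the line [ab] pointwise and multiplies lengths
    orthogonal to it by [1 + e * edist a b ^ 2]. *)
Definition widen (a b : pt) (e : R) (p : pt) : pt :=
  (fst p - e * orient a b p * (snd b - snd a),
   snd p + e * orient a b p * (fst b - fst a)).

Lemma widen_sqr a b e p p' :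
  edist (widen a b e p) (widen a b e p') ^ 2 =
  edist p p' ^ 2 + (2 * e + e ^ 2 * edist a b ^ 2)
                   * (orient a b p - orient a b p') ^ 2.
Proof. rewrite !edist_sqr; unfold widen, orient; simpl; ring. Qed.

Lemma widen_ge a b e p p' : 0 < e ->
  edist p p' <= edist (widen a b e p) (widen a b e p').
Proof.
intros He; apply le_of_sqr; [apply edist_nonneg|].
rewrite widen_sqr.
assert (0 <= e ^ 2 * edist a b ^ 2) by (apply Rmult_le_pos; apply pow2_ge_0).
pose proof (pow2_ge_0 (orient a b p - orient a b p')); nra.
Qed.

Lemma widen_gt a b e p p' : 0 < e -> orient a b p <> orient a b p' ->
  edist p p' < edist (widen a b e p) (widen a b e p').
Proof.
intros He Ho; apply Rnot_le_lt; intros Hle.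
pose proof (widen_sqr a b e p p') as Hs.
pose proof (edist_nonneg (widen a b e p) (widen a b e p')).
assert (0 <= e ^ 2 * edist a b ^ 2) by (apply Rmult_le_pos; apply pow2_ge_0).
assert (0 < (orient a b p - orient a b p') ^ 2)
  by (rewrite <- Rsqr_pow2; apply Rsqr_pos_lt; lra).
nra.
Qed.

Lemma widen_inj a b e p p' : 0 < e ->
  widen a b e p = widen a b e p' -> p = p'.
Proof.
intros He Heq; apply NNPP; intros Hne; apply edist_pos in Hne.
pose proof (widen_ge a b e p p' He) as Hge.
rewrite Heq, edist_refl in Hge; lra.
Qed.

Lemma widen_left a b e : widen a b e a = a.
Proof.
unfold widen, orient; destruct a as [a1 a2]; simpl; f_equal; ring.
Qed.

Lemma widen_right a b e : widen a b e b = b.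
Proof.
unfold widen, orient; destruct b as [b1 b2]; simpl; f_equal; ring.
Qed.

Lemma widen_0 a b p : widen a b 0 p = p.
Proof. unfold widen; destruct p as [p1 p2]; simpl; f_equal; ring. Qed.

Lemma orient_widen a b e x y s :
  orient (widen a b e x) (widen a b e y) (widen a b e s) =
  (1 + e * edist a b ^ 2) * orient x y s.
Proof. rewrite edist_sqr; unfold widen, orient; simpl; ring. Qed.

Lemma orient_scale_pos a b e : 0 < e -> 0 < 1 + e * edist a b ^ 2.
Proof. intros He; pose proof (pow2_ge_0 (edist a b)); nra. Qed.

Lemma near0_blocked a b x y s t : blocked x y s t ->
  near0 (fun e => blocked (widen a b e x) (widen a b e y)
                          (widen a b e s) (widen a b e t)).
Proof.
intros [Hs [Ht Hb]].
apply (near0_imp (fun e =>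
  0 < chord (widen a b e x) (widen a b e y) (widen a b e s) * orient x y t
    - chord (widen a b e x) (widen a b e y) (widen a b e t) * orient x y s)).
- intros e He Hpos; unfold blocked; rewrite !orient_widen.
  pose proof (orient_scale_pos a b e He); repeat split; nra.
- apply near0_pos.
  + unfold chord, inner, widen; simpl; reg.
  + rewrite !widen_0; lra.
Qed.

Lemma near0_incircle a b x y u s : incircle x y u s <> 0 ->
  near0 (fun e => incircle (widen a b e x) (widen a b e y)
                           (widen a b e u) (widen a b e s) <> 0).
Proof.
intros Hi.
apply (near0_imp (fun e => 0 < incircle (widen a b e x) (widen a b e y)
                           (widen a b e u) (widen a b e s) ^ 2)).
- intros e _ H0 H1; rewrite H1 in H0; lra.
- apply near0_pos.
  + unfold incircle, inner, orient, widen; simpl; reg.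
  + rewrite !widen_0, <- Rsqr_pow2; now apply Rsqr_pos_lt.
Qed.

Lemma near0_edges a b X : general_position X ->
  near0 (fun e => forall x y, In x X -> In y X -> x <> y ->
    delaunay_edge (map (widen a b e) X) (widen a b e x) (widen a b e y) ->
    delaunay_edge X x y).
Proof.
intros HX.
apply (near0_imp (fun e => forall c, In c (list_prod X X) -> fst c <> snd c ->
  delaunay_edge (map (widen a b e) X) (widen a b e (fst c)) (widen a b e (snd c))
  -> delaunay_edge X (fst c) (snd c))).
{ intros e _ H x y Hx Hy; apply (H (x, y)); now apply in_prod. }
apply near0_forall; intros [x y] Hxy; apply in_prod_iff in Hxy; simpl.
destruct Hxy as [Hx Hy].
destruct (classic (x <> y /\ ~ delaunay_edge X x y)) as [[Hne Hno]|Hyes].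
- destruct (edge_or_blocked X x y HX Hx Hy Hne Hno) as [s [t [Hs [Ht Hb]]]].
  apply (near0_imp _ _) with (2 := near0_blocked a b x y s t Hb).
  intros e _ Hb' _ Hed; exfalso; revert Hed.
  apply blocked_not_edge with (3 := Hb'); now apply in_map.
- apply near0_true; intros e _ Hne _; apply NNPP; tauto.
Qed.

Lemma NoDup_preimage (A B : Type) (f : A -> B) (X : list A) (l : list B) :
  NoDup l -> incl l (map f X) ->
  exists k, l = map f k /\ NoDup k /\ incl k X.
Proof.
induction l as [|v l IH]; intros Hnd Hin.
- exists []; split; [reflexivity|split; [constructor|intros u []]].
- inversion_clear Hnd as [|? ? Hv Hnd'].
  destruct (IH Hnd') as [k [-> [Hk HkX]]].
  { intros u Hu; apply Hin; now right. }
  destruct (proj1 (in_map_iff f X v) (Hin v (or_introl eq_refl)))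
    as [u [<- Hu]].
  exists (u :: k); split; [reflexivity|split].
  + constructor; [|assumption].
    intros Huk; apply Hv; now apply in_map.
  + intros w [<-|Hw]; auto.
Qed.

Lemma near0_general_position a b X : general_position X ->
  near0 (fun e => general_position (map (widen a b e) X)).
Proof.
intros [Hcol Hcoc].
set (good e (c : (pt * pt) * (pt * pt)) :=
  let '((x, y), (u, s)) := c in
  NoDup [x; y; u; s] ->
  ~ cocircular (map (widen a b e) [x; y; u; s])).
apply (near0_imp (fun e => forall c,
  In c (list_prod (list_prod X X) (list_prod X X)) -> good e c)).
- intros e He Hgood; split.
  + intros x' y' u' Hnd Hin Hc.
    destruct (NoDup_preimage _ _ _ _ _ Hnd Hin) as [k [Hk [Hndk HkX]]].
    destruct k as [|x [|y [|u [|]]]]; try discriminate.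
    injection Hk as -> -> ->.
    apply (Hcol x y u Hndk HkX).
    fold (orient (widen a b e x) (widen a b e y) (widen a b e u)) in Hc.
    unfold collinear in *.
    pose proof (orient_widen a b e x y u) as E; unfold orient in E.
    rewrite Hc in E; symmetry in E; apply Rmult_integral in E.
    pose proof (orient_scale_pos a b e He).
    destruct E as [E|E]; [lra|assumption].
  + intros x' y' u' s' Hnd Hin Hc.
    destruct (NoDup_preimage _ _ _ _ _ Hnd Hin) as [k [Hk [Hndk HkX]]].
    destruct k as [|x [|y [|u [|s [|]]]]]; try discriminate.
    injection Hk as -> -> -> ->.
    apply (Hgood ((x, y), (u, s))); [|assumption|assumption].
    repeat apply in_prod; apply HkX; simpl; tauto.
- apply near0_forall; intros [[x y] [u s]] Hc; unfold good.
  destruct (classic (NoDup [x; y; u; s])) as [Hnd|Hnd];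
    [|apply near0_true; tauto].
  apply in_prod_iff in Hc; destruct Hc as [H1 H2].
  apply in_prod_iff in H1, H2.
  assert (Hin : incl [x; y; u; s] X)
    by (intros v [<-|[<-|[<-|[<-|[]]]]]; tauto).
  assert (Hi : incircle x y u s <> 0).
  { intros Hi; apply (Hcoc x y u s Hnd Hin).
    apply incircle_cocircular; [|assumption].
    apply (Hcol x y u).
    - apply NoDup_remove_1 with (l := [x; y; u]) (l' := []) (a := s); exact Hnd.
    - intros v Hv; apply Hin; simpl in *; tauto. }
  apply (near0_imp _ _) with (2 := near0_incircle a b x y u s Hi).
  intros e _ Hie _ Hco; apply Hie; now apply cocircular_incircle.
Qed.

Lemma dt_path_preimage X f u' v' p' :
  (forall x y, In x X -> In y X -> x <> y ->
     delaunay_edge (map f X) (f x) (f y) -> delaunay_edge X x y) ->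
  dt_path (map f X) u' v' p' ->
  exists u v p, u' = f u /\ v' = f v /\ p' = map f p /\ dt_path X u v p.
Proof.
intros Hedge; induction 1 as [x' Hx'|x' y' z' p' He _ IH].
- apply in_map_iff in Hx'; destruct Hx' as [x [<- Hx]].
  exists x, x, [x]; repeat split; now constructor.
- destruct IH as [y [w [p [-> [-> [-> Hp]]]]]].
  assert (Hx' : In x' (map f X)) by (apply He; now left).
  apply in_map_iff in Hx'; destruct Hx' as [x [<- Hx]].
  exists x, w, (x :: p); repeat split.
  apply dt_path_edge with y; [|assumption].
  apply Hedge; [assumption|now apply (dt_path_start_in X y w p)| |assumption].
  intros ->; now apply (proj1 He).
Qed.

Lemma path_length_map_ge (f : pt -> pt) p :
  (forall x y, edist x y <= edist (f x) (f y)) ->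
  path_length p <= path_length (map f p).
Proof.
intros Hf; induction p as [|x [|y p] IH]; [simpl; lra|simpl; lra|].
change (edist x y + path_length (y :: p)
        <= edist (f x) (f y) + path_length (map f (y :: p))).
specialize (Hf x y); lra.
Qed.

(** * The stretch factor *)

(** The sites [(-2, 0)], [(2, 0)], [(0, 1)], [(0, -1)] form a kite in which the
    angles at the last two add up to more than [PI], so that its long diagonal
    is not a Delaunay edge. *)
Lemma stretch_bound_gt_1 lambda : stretch_bound lambda -> 1 < lambda.
Proof.
set (a := (-2, 0) : pt); set (b := (2, 0) : pt).
set (c := (0, 1) : pt); set (d := (0, -1) : pt).
intros Hst; destruct (Hst [a; b; c; d]) with (x := a) (y := b)
  as [p [Hp Hlen]]; [split|now left|right; now left|].
- intros x y u Hnd Hin Hcol; unfold collinear in Hcol.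
  pose proof (Hin x ltac:(simpl; tauto)) as Hx.
  pose proof (Hin y ltac:(simpl; tauto)) as Hy.
  pose proof (Hin u ltac:(simpl; tauto)) as Hu.
  inversion_clear Hnd as [|? ? Hn1 Hnd']; inversion_clear Hnd' as [|? ? Hn2 _].
  simpl in Hn1, Hn2.
  destruct Hx as [<-|[<-|[<-|[<-|[]]]]], Hy as [<-|[<-|[<-|[<-|[]]]]],
    Hu as [<-|[<-|[<-|[<-|[]]]]]; try tauto;
    unfold a, b, c, d in Hcol; simpl in Hcol; lra.
- intros x y u s Hnd Hin [o [r Hcirc]].
  (* the four sites of a cocircular quadruple are all the sites *)
  assert (Hall : forall v, In v [a; b; c; d] -> edist o v = r).
  { intros v Hv; apply (proj1 (Forall_forall _ _) Hcirc).
    revert v Hv; apply NoDup_length_incl; [assumption|simpl; lia|assumption]. }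
  assert (Hsq : forall v w, In v [a; b; c; d] -> In w [a; b; c; d] ->
                  edist o v ^ 2 = edist o w ^ 2)
    by (intros v w Hv Hw; now rewrite !Hall).
  pose proof (Hsq a b ltac:(simpl; tauto) ltac:(simpl; tauto)) as Hab.
  pose proof (Hsq c d ltac:(simpl; tauto) ltac:(simpl; tauto)) as Hcd.
  pose proof (Hsq a c ltac:(simpl; tauto) ltac:(simpl; tauto)) as Hac.
  rewrite !edist_sqr in Hab, Hcd, Hac; simpl in *; nra.
- assert (Hab : edist a b = 4).
  { apply Rle_antisym; apply le_of_sqr; try apply edist_nonneg; try lra;
      rewrite edist_sqr; simpl; lra. }
  assert (Hside : forall v, v = c \/ v = d -> 2 < edist a v /\ 2 < edist v b).
  { intros v Hv; pose proof (edist_nonneg a v); pose proof (edist_nonneg v b).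
    pose proof (edist_sqr a v) as E1; pose proof (edist_sqr v b) as E2.
    destruct Hv as [-> | ->]; simpl fst in *; simpl snd in *; nra. }
  enough (4 < path_length p) by nra.
  assert (Hv : exists v, In v p /\ (v = c \/ v = d)).
  { destruct (dt_path_first_edge _ _ _ _ Hp) as [y [He Hyp]].
    - intros E; rewrite E, edist_refl in Hab; lra.
    - exists y; split; [assumption|].
      assert (Hy : In y [a; b; c; d])
        by (apply (dt_path_incl _ _ _ _ Hp); assumption).
      destruct Hy as [<-|[<-|[<-|[<-|[]]]]]; try tauto.
      + exfalso; now apply (proj1 He).
      + exfalso; revert He; apply blocked_not_edge with c d;
          [simpl; tauto|simpl; tauto|].
        unfold blocked, chord, inner, orient; simpl; repeat split; lra. }
  destruct Hv as [v [Hvp Hv]].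
  pose proof (dt_path_ge_detour _ _ _ _ v Hp Hvp).
  specialize (Hside v Hv); lra.
Qed.

(** The stretch bound is used for a slightly stretched copy of [X], because
    applied to [X] itself it would allow vertices on the boundary of the
    ellipse. *)
Lemma ellipse_path_exists lambda X a b :
  stretch_bound lambda -> general_position X -> In a X -> In b X -> a <> b ->
  exists p, ellipse_path X lambda a b p /\ path_length p <= lambda * edist a b.
Proof.
intros Hst HX Ha Hb Hab.
pose proof (stretch_bound_gt_1 lambda Hst) as Hl.
destruct (near0_and _ _ (near0_general_position a b X HX)
            (near0_edges a b X HX)) as [d [Hd Hnear]].
destruct (Hnear (d / 2)) as [Hgp Hedge]; [lra|].
set (f := widen a b (d / 2)) in *.
assert (He : 0 < d / 2) by lra.
assert (Hexp : forall x y, edist x y <= edist (f x) (f y))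
  by (intros x y; now apply widen_ge).
assert (Hfa : f a = a) by apply widen_left.
assert (Hfb : f b = b) by apply widen_right.
destruct (Hst (map f X) Hgp a b) as [p' [Hp' Hlen]];
  [rewrite <- Hfa; now apply in_map|rewrite <- Hfb; now apply in_map|].
assert (Hp0 := Hp').
apply dt_path_preimage in Hp'; [|exact Hedge].
destruct Hp' as [u [v [p [Hu [Hv [-> Hp]]]]]].
assert (Hu' : a = u)
  by (apply (widen_inj a b (d / 2)); [assumption|fold f; congruence]).
assert (Hv' : b = v)
  by (apply (widen_inj a b (d / 2)); [assumption|fold f; congruence]).
subst u v.
exists p; split; [split; [assumption|]|].
- apply Forall_forall; intros x Hx; unfold in_ellipse.
  assert (Hxi : In x X) by now apply (dt_path_incl X a b p Hp).
  pose proof (edist_pos a b Hab) as Hpos.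
  destruct (classic (x = a \/ x = b)) as [[-> | ->]|Hxab].
  + rewrite edist_refl; nra.
  + rewrite edist_refl, (edist_sym b a); nra.
  + assert (Ho : orient a b x <> 0).
    { apply not_or_and in Hxab; destruct Hxab.
      apply (proj1 HX); [|intros w [<-|[<-|[<-|[]]]]; assumption].
      repeat constructor; simpl; intuition (subst; auto). }
    pose proof (dt_path_ge_detour _ _ _ _ (f x) Hp0 (in_map f p x Hx)) as Hdet.
    assert (Hax : edist a x < edist (f a) (f x)).
    { apply widen_gt; [assumption|]; unfold orient in *; lra. }
    pose proof (Hexp x b) as Hxb.
    rewrite Hfa in Hax; rewrite Hfb in Hxb.
    rewrite (edist_sym x a); lra.
- pose proof (path_length_map_ge f p Hexp); lra.
Qed.

(** * Concatenation along the walk *)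

Lemma cone_walk_head X q z s : cone_walk X q z s -> s = z :: tl s.
Proof. now destruct 1. Qed.

Lemma next_stopper_site X q z w : next_stopper X q z w -> In w X /\ z <> w.
Proof. intros [_ [r [_ [Hw [Hwz _]]]]]; split; auto. Qed.

Lemma competitive_path_head X lambda w s P :
  competitive_path X lambda (w :: s) P -> P = w :: tl P.
Proof.
intros H; inversion H as [u|u v t p Q [[Hp _] _] HQ]; [reflexivity|].
now rewrite (dt_path_head _ _ _ _ Hp).
Qed.

Lemma competitive_path_exists lambda X q z s :
  stretch_bound lambda -> general_position X -> In z X -> cone_walk X q z s ->
  exists P, competitive_path X lambda s P.
Proof.
intros Hst HX Hz Hs; revert Hz.
induction Hs as [z Hend|z w s Hstep Hs IH]; intros Hz.
- exists [z]; constructor.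
- destruct (next_stopper_site _ _ _ _ Hstep) as [Hw Hzw].
  destruct (IH Hw) as [P HP].
  destruct (ellipse_path_exists lambda X z w Hst HX Hz Hw Hzw) as [p0 [Hp0 _]].
  destruct (shortest_exists _ _ _ _ _ Hp0) as [p Hp].
  exists (p ++ tl P).
  rewrite (cone_walk_head _ _ _ _ Hs) in *; now constructor.
Qed.

Lemma competitive_path_length lambda X q z s P :
  lambda <= 1.998 -> stretch_bound lambda -> general_position X -> In z X ->
  cone_walk X q z s -> competitive_path X lambda s P ->
  path_length P <= 3.7 * edist z q.
Proof.
intros Hl Hst HX Hz Hs; revert Hz P.
induction Hs as [z Hend|z w s Hstep Hs IH]; intros Hz P HP.
- inversion_clear HP; simpl; pose proof (edist_nonneg z q); lra.
- destruct (next_stopper_site _ _ _ _ Hstep) as [Hw Hzw].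
  rewrite (cone_walk_head _ _ _ _ Hs) in HP.
  inversion HP as [|u v t p Q Hp HQ E1 E2]; subst.
  rewrite <- (cone_walk_head _ _ _ _ Hs) in HQ.
  specialize (IH Hw Q HQ).
  rewrite (cone_walk_head _ _ _ _ Hs) in HQ.
  destruct Hp as [[Hp _] Hmin].
  rewrite (path_length_app_tl X z w p Q Hp (competitive_path_head _ _ _ _ _ HQ)).
  destruct (ellipse_path_exists lambda X z w Hst HX Hz Hw Hzw)
    as [p0 [Hp0 Hlen]].
  specialize (Hmin p0 Hp0).
  pose proof (stopper_progress _ _ _ _ Hstep).
  pose proof (edist_nonneg z w); nra.
Qed.

Theorem lemma4 (lambda : R) (hlambda : lambda <= 1.998)
  (hstretch : stretch_bound lambda)
  (X : list pt) (hX : general_position X)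
  (z : pt) (hz : In z X) (q : pt) :
  (exists s, cone_walk X q z s) /\
  (forall s, cone_walk X q z s ->
     (exists P, competitive_path X lambda s P) /\
     (forall P, competitive_path X lambda s P ->
        path_length P <= 3.7 * edist z q)).
Proof.
split; [now apply cone_walk_exists|]; intros s Hs; split.
- now apply competitive_path_exists with q z.
- intros P HP; now apply competitive_path_length with lambda X s.
Qed.
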